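(* Let $k\ge 1$ and let $n_1,\ldots,n_k$ be positive integers. Then the domination polynomial of the complete multipartite graph $K_{n_1,\ldots,n_k}$ is unimodal.
   Context: $K_{n_1,\ldots,n_k}$ is the graph whose vertex set is partitioned into parts of sizes $n_1,\ldots,n_k$, two vertices being adjacent if and only if they lie in different parts. A subset $S$ of the vertices of a graph $G$ is a dominating set if every vertex of $G$ is either in $S$ or adjacent to a vertex of $S$. Let $d_i(G)$ be the number of dominating sets of $G$ of cardinality $i$. The domination polynomial of $G$ is $D(G,x)=\sum_{i} d_i(G)x^i$, where $0\le i\le |V(G)|$ (coefficients below the domination number are $0$). A real polynomial $a_0+a_1x+\cdots+a_nx^n$ is unimodal if there is $0\le k\le n$ with $a_0\le a_1\le\cdots\le a_k\ge a_{k+1}\ge\cdots\ge a_n$. *)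

(* Defs.v *)
From mathcomp Require Import all_boot all_order all_algebra.

Set Implicit Arguments.
Unset Strict Implicit.
Unset Printing Implicit Defensive.

Import Order.TTheory GRing.Theory Num.Theory.

(* A finite simple graph is a finType T of vertices together with a symmetric
   irreflexive adjacency relation e : rel T. *)

Section Domination.

Variables (T : finType) (e : rel T).

Definition dominating (S : {set T}) : bool :=
  [forall v, (v \in S) || [exists u in S, e v u]].

Definition num_dominating (i : nat) : nat :=
  #|[set S : {set T} | dominating S & #|S| == i]|.

Definition domination_poly (R : nzRingType) : {poly R} :=
  (\poly_(i < #|T|.+1) (num_dominating i)%:R)%R.

End Domination.

(* The vertex set is the disjoint union of the parts 'I_(n i), i : 'I_k, so
   [tag u] is the part that contains u. *)
Definition multipartite_vertex (k : nat) (n : 'I_k -> nat) : finType :=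
  {i : 'I_k & 'I_(n i)}.

Definition complete_multipartite (k : nat) (n : 'I_k -> nat) :
    rel (multipartite_vertex n) :=
  fun u v => tag u != tag v.

Lemma complete_multipartite_sym k (n : 'I_k -> nat) :
  symmetric (@complete_multipartite k n).
Proof. by move=> u v; rewrite /complete_multipartite eq_sym. Qed.

Lemma complete_multipartite_irr k (n : 'I_k -> nat) :
  irreflexive (@complete_multipartite k n).
Proof. by move=> u; rewrite /complete_multipartite eqxx. Qed.

(* [(size p).-1] is the degree of p, and 0 for p = 0. *)
Definition unimodal (R : numDomainType) (p : {poly R}) : Prop :=
  exists m : nat,
    [/\ m <= (size p).-1,
        forall i, i < m -> (p`_i <= p`_i.+1)%R
      & forall i, m <= i < (size p).-1 -> (p`_i.+1 <= p`_i)%R].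

(* Main.v *)
(** Dominating sets are closed under supersets, so by double counting
    [(N - i) d_i <= (i + 1) d_(i+1)], where [N] is the number of vertices; hence
    [d] increases up to [N / 2].  For [i >= N / 2] a non-dominating [i]-set is a
    proper subset of a part with more than [N / 2] vertices, and at most one
    part, of size [n] say, is that large.  So there [d_i = C(N, i) - C(n, i)]
    for [i < n] and [d_i = C(N, i)] for [i >= n].  For [i + 1 < n],
    [d_(i+1) <= d_i] amounts to [C(N, i) / C(n, i) >= (2i + 1 - n) / (2i + 1 - N)];
    the left-hand side increases with [i] and the right-hand side decreases, so
    once [d] has started to decrease it keeps decreasing, up to [i = n - 1].  The step
    from [n - 1] to [n], where the formula changes, is a decrease as soon as
    [N + 3 <= 2n] and [n < N]; if [n = N], then [d_i = 0] for all [i < N]. *)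
Require Import Defs.
From mathcomp Require Import all_boot all_order all_algebra.
From mathcomp Require Import zify.

Set Implicit Arguments.
Unset Strict Implicit.
Unset Printing Implicit Defensive.

(** The peak is the least [i >= h] with [d i.+1 <= d i], which exists because [N] qualifies;
    minimality gives the increase from [h] up to it. *)
Lemma unimodal_seq_of_decrease_persists (d : nat -> nat) (N h : nat) :
  h <= N -> d N.+1 <= d N ->
  (forall i, i < h -> d i <= d i.+1) ->
  (forall i, h <= i -> d i.+1 <= d i -> d i.+2 <= d i.+1) ->
  exists m, [/\ m <= N, forall i, i < m -> d i <= d i.+1
                      & forall i, m <= i -> d i.+1 <= d i].
Proof.
move=> hN dN incr decr.
have exP : exists i, (h <= i) && (d i.+1 <= d i) by exists N; rewrite hN.
case: (ex_minnP exP) => m /andP[hm dm] m_min; exists m; split.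
- by apply: m_min; rewrite hN.
- move=> i im; have [/incr//|hi] := ltnP i h.
  rewrite ltnW // ltnNge; apply/negP => di.
  by have := m_min i; rewrite hi di => /(_ isT); rewrite leqNgt im.
- move=> i mi; rewrite -(subnKC mi); elim: (i - m) => [|j IH]; first by rewrite addn0.
  by rewrite addnS; apply: decr IH; rewrite (leq_trans hm) // leq_addr.
Qed.

Section DominatingSets.

Variables (T : finType) (e : rel T).

Lemma dominatingS (A B : {set T}) :
  A \subset B -> dominating e A -> dominating e B.
Proof.
move=> sAB /forallP domA; apply/forallP => v.
have /orP[/(subsetP sAB)->//|/existsP[u /andP[uA evu]]] := domA v.
by apply/orP; right; apply/existsP; exists u; rewrite (subsetP sAB).
Qed.

Lemma num_dominating_mul_le (i : nat) :
  (#|T| - i) * num_dominating e i <= i.+1 * num_dominating e i.+1.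
Proof.
pose D j := [set S : {set T} | dominating e S & #|S| == j].
pose Out := [set p : {set T} * T | (p.1 \in D i) && (p.2 \notin p.1)].
pose In := [set p : {set T} * T | (p.1 \in D i.+1) && (p.2 \in p.1)].
have card_pairs j (r : {set T} -> {set T}) c :
    (forall S, S \in D j -> #|r S| = c) ->
    #|[set p : {set T} * T | (p.1 \in D j) && (p.2 \in r p.1)]| = c * #|D j|.
  move=> rc; rewrite -sum1dep_card.
  rewrite -(pair_big_dep (mem (D j)) (fun S v => v \in r S) (fun _ _ => 1)) /=.
  under eq_bigr => S SD do rewrite sum1_card rc //.
  by rewrite sum_nat_const mulnC.
have OutE : #|Out| = (#|T| - i) * num_dominating e i.
  rewrite -[num_dominating e i]/#|D i| -(card_pairs i (fun S => ~: S)).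
    by apply: eq_card => p; rewrite !inE.
  by move=> S; rewrite inE => /andP[_ /eqP<-]; rewrite cardsCs setCK.
have InE : #|In| = i.+1 * num_dominating e i.+1.
  rewrite -[num_dominating e i.+1]/#|D i.+1| -(card_pairs i.+1 id) //.
  by move=> S; rewrite inE => /andP[_ /eqP].
rewrite -OutE -InE.
(* Keeping [v] in the pair makes [add] injective on [Out]: removing [v] recovers [S]. *)
pose add (p : {set T} * T) := (p.2 |: p.1, p.2).
rewrite -(card_in_imset (f := add)) => [|[S v] [S' v']].
  apply/subset_leq_card/subsetP => _ /imsetP[[S v] + ->].
  rewrite !inE /= => /andP[/andP[domS /eqP cS] vS].
  by rewrite (dominatingS (subsetUr _ _) domS) cardsU1 vS cS !eqxx.
rewrite !inE /= => /andP[_ vS] /andP[_ vS'] [SS' vv'].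
by rewrite -vv' in SS' vS' *; rewrite -(setU1K vS) SS' setU1K.
Qed.

Lemma num_dominating_le_succ (i : nat) :
  i.*2 < #|T| -> num_dominating e i <= num_dominating e i.+1.
Proof. move=> iT; have := num_dominating_mul_le i; nia. Qed.

Lemma num_dominating_add_compl (i : nat) :
  num_dominating e i + #|[set S : {set T} | ~~ dominating e S & #|S| == i]|
    = 'C(#|T|, i).
Proof.
rewrite -card_draws -[RHS](cardsID [set S : {set T} | dominating e S]).
by congr (_ + _); apply: eq_card => S; rewrite !inE andbC.
Qed.

End DominatingSets.

Section CompleteMultipartite.

Variables (k : nat) (n : 'I_k -> nat).

Local Notation V := (multipartite_vertex n).

Definition part (j : 'I_k) : {set V} := [set u | tag u == j].

Lemma card_part (j : 'I_k) : #|part j| = n j.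
Proof.
have inj : injective (fun x : 'I_(n j) => Tagged (fun i => 'I_(n i)) x : V).
  by move=> x y /eqP; rewrite eq_Tagged => /eqP.
rewrite -[RHS]card_ord -cardsT -(card_imset _ inj); apply: eq_card => -[i x].
rewrite inE /=; apply/eqP/imsetP => [ij|[y _ /(congr1 tag)]] //.
by case: _ / ij; exists x.
Qed.

Lemma part_le_card (j : 'I_k) : n j <= #|{: V}|.
Proof. by rewrite -card_part max_card. Qed.

Lemma two_parts_le_card (i j : 'I_k) : i != j -> n i + n j <= #|{: V}|.
Proof.
move=> ij; rewrite -!card_part -cardsUI.
rewrite (_ : part i :&: part j = set0) ?cards0 ?addn0 ?max_card //.
apply/setP => u; rewrite !inE; apply/negbTE/negP => /andP[/eqP-> ].
exact/negP.
Qed.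

(** A vertex outside [S] with no neighbour in [S] shares its part with all of [S], and it witnesses
    that the inclusion in that part is proper. *)
Lemma nondominating_multipartite (S : {set V}) : S != set0 ->
  ~~ dominating (@complete_multipartite k n) S = [exists j, S \proper part j].
Proof.
move=> /set0Pn[u uS]; apply/idP/existsP => [|[j /properP[sSj [v vj vS]]]].
  rewrite negb_forall => /existsP[v]; rewrite negb_or => /andP[vS].
  rewrite negb_exists => /forallP nadj; exists (tag v); apply/properP; split.
    apply/subsetP => w wS; have := nadj w.
    by rewrite wS /complete_multipartite negbK inE eq_sym.
  by exists v; rewrite ?inE.
rewrite negb_forall; apply/existsP; exists v; rewrite negb_or vS /=.
rewrite negb_exists; apply/forallP => w; rewrite negb_and.
have [wS /=|//] := boolP (w \in S).
have := subsetP sSj _ wS; rewrite /complete_multipartite !inE in vj *.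
by move=> /eqP->; rewrite negbK.
Qed.

Variable j : 'I_k.
Hypothesis n_max : forall i, n i <= n j.

Lemma num_dominating_multipartite (i : nat) : 0 < i -> #|{: V}| <= i.*2 ->
  num_dominating (@complete_multipartite k n) i
    + (if i < n j then 'C(n j, i) else 0) = 'C(#|{: V}|, i).
Proof.
move=> i0 Ni; rewrite -(num_dominating_add_compl (@complete_multipartite k n)).
congr (_ + _).
(* A part [l] other than [j] properly containing [S] would give [n j >= n l > i], so these two parts
   would have more than [2i >= N] vertices together. *)
have cond (S : {set V}) : #|S| = i ->
    ~~ dominating (@complete_multipartite k n) S = (S \proper part j).
  move=> cS; rewrite nondominating_multipartite -?card_gt0 ?cS //.
  apply/existsP/idP => [[l Sl]|]; last by exists j.
  have [<-//|/two_parts_le_card] := eqVneq l j.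
  have := proper_card Sl; rewrite card_part cS; have := n_max l; lia.
case: ltnP => ij.
  rewrite -card_part -cards_draws; apply: eq_card => S; rewrite !inE.
  have [cS|] := eqVneq #|S| i; last by rewrite !andbF.
  by rewrite cond // properEcard cS card_part ij !andbT.
apply/esym/eqP; rewrite cards_eq0; apply/eqP/setP => S; rewrite !inE.
have [cS|] := eqVneq #|S| i; last by rewrite andbF.
by rewrite cond // properEcard cS card_part ltnNge ij andbF.
Qed.

End CompleteMultipartite.

Lemma bin_succ_le_of_half (N i : nat) : N <= i.*2.+1 -> 'C(N, i.+1) <= 'C(N, i).
Proof. move=> Ni; have := mul_bin_left N i; nia. Qed.

Lemma bin_diff_decrease_persists (N n i : nat) :
  n <= N -> N <= i.*2 -> i < n ->
  'C(N, i.+1) + 'C(n, i) <= 'C(N, i) + 'C(n, i.+1) ->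
  'C(N, i.+2) + 'C(n, i.+1) <= 'C(N, i.+1) + 'C(n, i.+2).
Proof.
move=> nN Ni ni.
have := mul_bin_left N i; have := mul_bin_left n i.
have := mul_bin_left N i.+1; have := mul_bin_left n i.+1.
move: 'C(N, i) 'C(N, i.+1) 'C(N, i.+2) => A A1 A2.
move: 'C(n, i) 'C(n, i.+1) 'C(n, i.+2) => B B1 B2 eB2 eA2 eB1 eA1 dec.
(* Multiplied by [i + 1], the decrease at [i] reads [q * B <= p * A]; at [i + 1], the numbers [p]
   and [q] both grow by 2. *)
pose p := i.*2.+1 - N; pose q := i.*2.+1 - n.
have pq : p <= q by rewrite /p /q; lia.
have p0 : 0 < p by rewrite /p; lia.
have pqAB : q * B <= p * A by rewrite /p /q; nia.
(* After multiplication by [q], the bound on [q * B] leaves [n - i <= N - i] and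
   [(q + 2) * p <= (p + 2) * q], that is [p <= q]. *)
have step : (q + 2) * ((n - i) * B) <= (p + 2) * ((N - i) * A).
  rewrite -(leq_pmul2l (leq_trans p0 pq)).
  apply: (@leq_trans ((q + 2) * (n - i) * (p * A))).
    by rewrite [leqLHS](_ : _ = (q + 2) * (n - i) * (q * B)); [rewrite leq_mul|lia].
  rewrite [leqRHS](_ : _ = (p + 2) * q * (N - i) * A); last lia.
  rewrite [leqLHS](_ : _ = (q + 2) * p * (n - i) * A); last lia.
  by rewrite leq_mul // leq_mul ?leq_sub2r //; lia.
have step1 : (q + 2) * B1 <= (p + 2) * A1.
  by rewrite -(leq_pmul2l (ltn0Sn i)) !(mulnCA i.+1) eB1 eA1.
(* Once the goal is multiplied by [i + 2], these splittings cancel the terms coming from [A2] and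
   [B2] and leave [step1]. *)
have eN : i.+2 = (N - i.+1) + (p + 2) by rewrite /p; lia.
have en : i.+2 = (n - i.+1) + (q + 2) by rewrite /q; lia.
rewrite -(leq_pmul2l (ltn0Sn i.+1)) !mulnDr eA2 eB2 {1}en eN !mulnDl.
move: step1; rewrite !mulnDl; lia.
Qed.

(** This serves the step where the formula for [d] changes: the summand [n] is ['C(n, n.-1)]. *)
Lemma bin_pred_sub_ge (N n : nat) : n < N -> N + 3 <= n.*2 ->
  'C(N, n) + n <= 'C(N, n.-1).
Proof.
case: n => [|n] nN Nn; first lia.
(* Here [n] is the predecessor. Multiplied by [n + 1], the goal is
   [(n + 1)^2 <= (2n + 1 - N) * 'C(N, n)], whose first factor is at least 2; and [n + 2 <= N]. *)
have big : n.+2 * n.+1 <= 2 * 'C(N, n).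
  have -> : n.+2 * n.+1 = 2 * 'C(n.+2, n).
    have := @bin_sub n.+2 2 isT; rewrite subn2 /= => ->.
    by have := mul_bin_diag n.+2 1; rewrite bin1.
  by rewrite leq_mul2l leq_bin2l.
rewrite -(leq_pmul2l (ltn0Sn n)); have := mul_bin_left N n => /=; nia.
Qed.

Theorem theorem2p5 (R : realFieldType) (k : nat) (n : 'I_k -> nat)
    (hk : 1 <= k) (hn : forall i : 'I_k, 0 < n i) :
  unimodal (domination_poly (@complete_multipartite k n) R).
Proof.
set e := @complete_multipartite k n; set N := #|{: multipartite_vertex n}|.
pose j := [arg max_(i > Ordinal hk) n i].
have n_max i : n i <= n j by rewrite /j; case: arg_maxnP => // i0 _; apply.
have n0 := hn j.
have nN : n j <= N := part_le_card n j.
have dE i : 0 < i -> N <= i.*2 ->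
    num_dominating e i + (if i < n j then 'C(n j, i) else 0) = 'C(N, i).
  exact: num_dominating_multipartite.
have dE_ge i : N <= i.*2 -> n j <= i -> num_dominating e i = 'C(N, i).
  move=> Ni ni; have i0 := leq_trans n0 ni.
  by rewrite -(dE i i0 Ni) ltnNge ni addn0.
(* The value at [N] fixes the degree; the zero at [N + 1] makes [N] a point of decrease. *)
have dN : num_dominating e N = 1 by rewrite dE_ge ?binn //; lia.
have dSN : num_dominating e N.+1 = 0 by rewrite dE_ge ?bin_small //; lia.
have [m [mN incr decr]] : exists m,
    [/\ m <= N, forall i, i < m -> num_dominating e i <= num_dominating e i.+1
              & forall i, m <= i -> num_dominating e i.+1 <= num_dominating e i].
  have low i : i.*2 < N -> num_dominating e i <= num_dominating e i.+1.
    exact: num_dominating_le_succ.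
  have [nN_eq|nN_neq] := eqVneq (n j) N.
    (* With a single part, [d] vanishes from [N / 2] to [N - 1], so the increasing range extends to
       [N]. *)
    apply: (@unimodal_seq_of_decrease_persists _ N N); rewrite ?dSN // => i iN.
      have [/low//|Ni] := ltnP i.*2 N.
      by have := dE i; rewrite nN_eq iN; lia.
    by move=> _; rewrite !dE_ge ?bin_small //; lia.
  apply: (@unimodal_seq_of_decrease_persists _ N (uphalf N)); rewrite ?dSN //.
  - lia.
  - by move=> i iN; apply: low; lia.
  move=> i Ni.
  have [ni|ni] := leqP (n j) i.+1.
    have -> : num_dominating e i.+2 = 'C(N, i.+2) by apply: dE_ge; lia.
    have -> : num_dominating e i.+1 = 'C(N, i.+1) by apply: dE_ge; lia.
    by move=> _; apply: bin_succ_le_of_half; lia.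
  have := dE i; have := dE i.+1; rewrite ni (ltnW ni) => d1 d0.
  have {}d0 := d0 ltac:(lia) ltac:(lia); have {}d1 := d1 isT ltac:(lia).
  have [ni2|ni2] := ltnP i.+2 (n j).
    have := dE i.+2; rewrite ni2 => d2; have {}d2 := d2 isT ltac:(lia).
    have := @bin_diff_decrease_persists N (n j) i; lia.
  (* At the change of formula the decrease holds whatever happened at [i]; [N <= 2i] gives
     [N + 3 <= 2 * n j]. *)
  have nE : n j = i.+2 by lia.
  have -> : num_dominating e i.+2 = 'C(N, i.+2) by apply: dE_ge; lia.
  have bin_le : 'C(N, i.+2) + i.+2 <= 'C(N, i.+1).
    by apply: (@bin_pred_sub_ge N i.+2); lia.
  by rewrite nE binSn in d1; lia.
have sizep : size (domination_poly e R) = N.+1.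
  by apply: size_poly_eq; rewrite dN GRing.oner_neq0.
have coefp i : i <= N -> ((domination_poly e R)`_i = (num_dominating e i)%:R)%R.
  by move=> iN; rewrite coef_poly ltnS iN.
exists m; rewrite sizep /=; split=> // i.
  by move=> im; rewrite !coefp ?Num.Theory.ler_nat ?incr //; lia.
by move=> /andP[mi iN]; rewrite !coefp ?Num.Theory.ler_nat ?decr //; lia.
Qed.
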